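(* Let $(X,\rho)$ be a finitely compact metric space in which any two points are connected by a geodesic. Then, for any finite $A,B\subset X$, there exists a shortest $(A,B)$-network in $X$.
   Context: A metric space is finitely compact if its closed and bounded subsets are compact. A geodesic connecting $x,y\in X$ is an arc from $x$ to $y$ of length $\rho(x,y)$. Digraphs are finite, and their edges are ordered pairs of distinct vertices; both $(x,y)$ and $(y,x)$ may be edges. For finite subsets $A,B$ of a metric space $(X,\rho)$, an $(A,B)$-network (directed network connecting $A$ to $B$) is a digraph $G=(V,E)$ such that $A\cup B\subseteq V\subseteq X$ and for each $a\in A$ and $b\in B$ there is a directed path from $a$ to $b$ in $G$ (a single vertex counts as a path from itself to itself). The length of $G$ is $\ell(G)=\sum_{(x,y)\in E}\rho(x,y)$. A shortest $(A,B)$-network in $X$ is an $(A,B)$-network whose length is minimum among all $(A,B)$-networks in $X$ (with no restriction on the number of vertices in $V\setminus(A\cup B)$). *)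

(* Defs.v *)
From HB Require Import structures.
From mathcomp Require Import all_boot all_order all_algebra.
From mathcomp Require Import finmap.
From mathcomp Require Import all_classical all_reals all_analysis.

Set Implicit Arguments.
Unset Strict Implicit.
Unset Printing Implicit Defensive.

Import Order.TTheory GRing.Theory Num.Theory.
Import numFieldNormedType.Exports.

Local Open Scope classical_set_scope.
Local Open Scope fset_scope.
Local Open Scope ring_scope.

Section MetricSpaces.
Context {R : realType} {X : metricType R}.

Definition mbounded (K : set X) : Prop :=
  exists M : R, forall x y, K x -> K y -> mdist x y <= M.

(* An arc is given by a parametrization on [0, 1]; a continuous injection from
   a compact space to a Hausdorff one is a homeomorphism onto its image.
   The values of [gamma] outside [0, 1] are irrelevant. *)
Definition is_arc (x y : X) (gamma : R -> X) : Prop :=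
  [/\ {within `[0, 1]%classic, continuous gamma},
      {in `[0, 1] &, injective gamma},
      gamma 0 = x & gamma 1 = y].

(* [itv_partition 0 1 s] means that [0 :: s] is strictly increasing and ends
   at 1. *)
Definition polygonal_length (gamma : R -> X) (s : seq R) : R :=
  \sum_(0 <= i < size s)
    mdist (gamma (nth 1 (0 :: s) i)) (gamma (nth 1 (0 :: s) i.+1)).

Definition arc_length (gamma : R -> X) : \bar R :=
  ereal_sup [set (polygonal_length gamma s)%:E | s in itv_partition 0 1].

Definition is_geodesic (x y : X) (gamma : R -> X) : Prop :=
  is_arc x y gamma /\ arc_length gamma = (mdist x y)%:E.

End MetricSpaces.

Definition finitely_compact (R : realType) (X : metricType R) : Prop :=
  forall K : set X, closed K -> mbounded K -> compact K.

(* A point is connected to itself by the degenerate arc reduced to that point,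
   so the condition only concerns distinct points (a map that is injective on
   [0, 1] cannot have equal endpoints). *)
Definition geodesically_connected (R : realType) (X : metricType R) : Prop :=
  forall x y : X, x <> y -> exists gamma : R -> X, is_geodesic x y gamma.

Record digraph (T : choiceType) := Digraph {
  vertices : {fset T};
  edges : {fset T * T};
  edgesP : forall e, e \in edges ->
    [&& e.1 \in vertices, e.2 \in vertices & e.1 != e.2]
}.

(* The vertices of the path are [a :: p]; [p] is empty when [a = b]. *)
Definition dipath (T : choiceType) (G : digraph T) (a b : T) (p : seq T) : Prop :=
  [/\ a \in vertices G, path (fun x y => (x, y) \in edges G) a p,
      uniq (a :: p) & last a p = b].

Section Networks.
Context {R : realType} {X : metricType R}.

Definition is_network (A B : {fset X}) (G : digraph X) : Prop :=
  A `|` B `<=` vertices G /\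
  forall a b, a \in A -> b \in B -> exists p, dipath G a b p.

Definition network_length (G : digraph X) : R :=
  \sum_(e <- edges G) mdist e.1 e.2.

Definition is_shortest_network (A B : {fset X}) (G : digraph X) : Prop :=
  is_network A B G /\
  forall H : digraph X, is_network A B H ->
    network_length G <= network_length H.

End Networks.

(* Main.v *)
Require Import Defs.
From HB Require Import structures.
From mathcomp Require Import all_boot all_order all_algebra finmap.
From mathcomp Require Import lra.
From mathcomp Require Import all_classical all_reals all_analysis.

(** Two facts give the theorem: a network can be replaced, without becoming
    longer, by one whose number of edges is bounded in terms of the number [n]
    of terminals only; and among the edge lists of bounded size a shortest one
    exists by compactness.

    Bounding the number of edges ([bounded_reduction]).  Call an edge a bridge
    if it lies on no directed cycle.  To a bridge [e] associate the set of
    terminals from which [e] can be reached and the set of those that can be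
    reached from [e].  If two bridges have the same pair of sets and one comes
    before the other, then these two, together with a directed path between
    them, can be replaced by one edge from the start of the first to the end of
    the second ([merge_bridges]); if neither comes before the other, one of
    them can be erased ([drop_bridge]).  Hence at most [4 ^ n] bridges are
    needed ([few_bridges]).

    The edges that lie on directed cycles form a union of strongly connected
    digraphs.  In them only the connections between the terminals and the ends
    of the bridges matter.  Keeping the directions of these edges would not lead
    to a bounded number of branching points: a directed path there and a
    directed path back can share arbitrarily many segments, met in opposite
    orders.  But the metric is symmetric, so that a new edge may replace any
    undirected trail joining its ends, as long as the trails used by different
    new edges are edge-disjoint.  By the undirected Menger theorem for two paths
    ([reach_two_trails]), a new point [t] is joined to what is already connected
    by two edge-disjoint trails; one of them is directed towards [t], the other
    one away from [t], as in an ear decomposition.  Thus each point costs at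
    most four new edges ([linkage_exists]).

    Compactness ([shortest_list]).  Edge lists of a given size [N] are points of
    a power of [X].  Those of bounded length that matter stay in a ball around a
    terminal, balls are compact, the length is continuous, and reachability
    between two fixed points is a closed condition ([closed_reach]), because
    close configurations cannot satisfy more equalities between their
    coordinates than the limit does. *)

Set Implicit Arguments.
Unset Strict Implicit.
Unset Printing Implicit Defensive.

Import Order.TTheory GRing.Theory Num.Theory.
Import numFieldNormedType.Exports.

(** * Reachability along a list of edges *)

Section Reachability.
Context {V : eqType}.
Implicit Types (E F : seq (V * V)) (e : V * V) (x y z : V).

Definition reach E x y : Prop :=
  exists2 p, path (fun u v => (u, v) \in E) x p & y = last x p.

Lemma reach_refl E x : reach E x x.
Proof. by exists [::]. Qed.

Lemma reach_edge E e : e \in E -> reach E e.1 e.2.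
Proof. by case: e => u v Euv; exists [:: v] => //=; rewrite Euv. Qed.

Lemma reach_trans E y x z : reach E x y -> reach E y z -> reach E x z.
Proof.
by move=> [p xp ->] [q yq ->]; exists (p ++ q); rewrite ?last_cat// cat_path xp.
Qed.

Lemma reach_invariant E (P : V -> Prop) x y :
  (forall e, e \in E -> P e.1 -> P e.2) -> P x -> reach E x y -> P y.
Proof.
move=> PE + [p + ->]; elim: p x => //= z p IHp x Px /andP[Exz zp].
exact/(IHp z)/zp/(PE _ Exz).
Qed.

Lemma sub_reach E F x y :
  (forall e, e \in E -> reach F e.1 e.2) -> reach E x y -> reach F x y.
Proof.
move=> EF; apply: reach_invariant (reach_refl F x) => e /EF Fe xe.
exact: reach_trans Fe.
Qed.

(** Serves to reroute a connection when the edges [F] are removed: in the second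
    case the outer parts of the path can be kept, up to an end of a removed
    edge. *)
Lemma reach_filter E F x y : reach E x y ->
  reach [seq e <- E | e \notin F] x y \/
  exists2 e, e \in F & reach E x e.1 /\ reach E e.2 y.
Proof.
case=> p + ->; elim: p x => [|z p IHp] x /=; first by left; exact: reach_refl.
case/andP=> Exz zp.
have xz : reach E x z := reach_edge Exz.
have [Fxz|Fxz] := boolP ((x, z) \in F).
  by right; exists (x, z) => //; split; [exact: reach_refl | exists p].
case: (IHp z zp) => [zl|[e Fe [ze el]]].
  left; apply: reach_trans zl; apply: (@reach_edge _ (x, z)).
  by rewrite mem_filter Fxz.
by right; exists e => //; split=> //; exact: reach_trans ze.
Qed.

End Reachability.

(** * Walks that may traverse edges backwards *)

Section Walks.
Context {V : eqType}.
Implicit Types (E : seq (V * V)) (e : V * V) (x y z : V).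

(** An edge with a direction of traversal; [true] means backwards. The edge is
    kept as the first component, so that edge-disjointness of [p] and [q] is
    uniqueness of [unzip1 (p ++ q)]. *)
Definition dart : Type := (V * V) * bool.
Implicit Types (s : dart) (p q r : seq dart) (W : seq V).

Definition src s : V := if s.2 then s.1.2 else s.1.1.
Definition tgt s : V := if s.2 then s.1.1 else s.1.2.
Definition flip s : dart := (s.1, ~~ s.2).
Definition forward (es : seq (V * V)) : seq dart := [seq (e, false) | e <- es].

Lemma src_flip s : src (flip s) = tgt s. Proof. by case: s => e []. Qed.
Lemma tgt_flip s : tgt (flip s) = src s. Proof. by case: s => e []. Qed.

Lemma unzip1_forward es : unzip1 (forward es) = es.
Proof. by rewrite /unzip1 /forward -map_comp map_id. Qed.

Fixpoint walk x p y : bool :=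
  if p is s :: p' then (src s == x) && walk (tgt s) p' y else x == y.

Lemma walk_cat x p q y z : walk x p y -> walk y q z -> walk x (p ++ q) z.
Proof.
elim: p x => [|s p IHp] x /=; first by move/eqP->.
by case/andP=> -> /IHp.
Qed.

Lemma walk_split x p s q z : walk x (p ++ s :: q) z ->
  walk x (rcons p s) (tgt s) /\ walk (tgt s) q z.
Proof.
elim: p x => [|s' p IHp] x /=; first by case/andP=> ->; rewrite eqxx.
by case/andP=> -> /IHp.
Qed.

Lemma walk_rev x p y : walk x p y -> walk y (rev (map flip p)) x.
Proof.
elim: p x => [|s p IHp] x /=; first by rewrite eq_sym.
case/andP=> /eqP <- /IHp; rewrite rev_cons -cats1 => /walk_cat; apply.
by rewrite /= src_flip tgt_flip !eqxx.
Qed.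

Lemma unzip1_rev_flip p : unzip1 (rev (map flip p)) = rev (unzip1 p).
Proof. by rewrite /unzip1 map_rev -map_comp. Qed.

Lemma walk_src x p y s : walk x p y -> s \in p -> src s \in x :: map tgt p.
Proof.
elim: p x => //= s' p IHp x /andP[/eqP xs' /IHp IH].
rewrite inE => /predU1P[->|/IH]; rewrite in_cons ?xs' ?eqxx// => ->.
by rewrite orbT.
Qed.

Lemma forward_reach E x es y : walk x (forward es) y -> {subset es <= E} ->
  reach E x y.
Proof.
elim: es x => [|e es IHes] x /=; first by move/eqP-> => _; exact: reach_refl.
case/andP=> /eqP <- ey esE; apply: (@reach_trans _ _ e.2).
  by apply: reach_edge; apply: esE; rewrite mem_head.
by apply: IHes ey _ => f fes; apply: esE; rewrite in_cons fes orbT.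
Qed.

Lemma forward_reach_mem E x es y e : walk x (forward es) y ->
  {subset es <= E} -> e \in es -> reach E x e.1 /\ reach E e.2 y.
Proof.
elim: es x => // f es IHes x /= /andP[/eqP <- fy] fesE.
have Ef : reach E f.1 f.2 by apply: reach_edge; apply: fesE; rewrite mem_head.
have esE : {subset es <= E}.
  by move=> g ges; apply: fesE; rewrite in_cons ges orbT.
rewrite inE => /predU1P[->|/(IHes _ fy esE)[fe ey]].
  by split; [exact: reach_refl | exact: forward_reach esE].
by split=> //; exact: reach_trans Ef fe.
Qed.

(** The last condition says that the walk stops at the first visit of [y]. It
    keeps a walk from [e.2] to [e.1] from using [e]. *)
Lemma simple_walk E x y : reach E x y -> exists2 es, walk x (forward es) y &
  [/\ uniq es, {subset es <= E} & forall e, e \in es -> e.1 != y].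
Proof.
case=> p0 /shortenP[p xp up _] ->.
have unz : unzip1 (zip (belast x p) p) = belast x p.
  by rewrite unzip1_zip// size_belast.
exists (zip (belast x p) p); last split.
- by elim: p x {xp up unz} => //= z p IHp x; rewrite eqxx IHp.
- apply: (@map_uniq _ _ fst); rewrite [map _ _]unz.
  by move: up; rewrite lastI rcons_uniq => /andP[].
- elim: p x xp {up unz} => //= z p IHp x /andP[Exz zp] e.
  by rewrite inE => /predU1P[->//|/IHp]; apply.
- move=> e /(map_f fst); rewrite [map _ _]unz => ebel.
  move: up; rewrite lastI rcons_uniq => /andP[+ _].
  by apply: contraNneq => <-.
Qed.

End Walks.
Arguments dart : clear implicits.

(** * Two edge-disjoint trails towards a set *)

Section Ears.
Context {V : eqType}.
Implicit Types (E : seq (V * V)) (e : V * V) (x y z : V) (W K : seq V).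
Implicit Types (s : dart V) (p q r : seq (dart V)).

(** Equivalently, every edge lies on a directed cycle: the digraph is a union of
    strongly connected ones. *)
Definition recurrent E : Prop := forall e, e \in E -> reach E e.2 e.1.

(** Each edge of a path can be undone by the return path that [recurrent]
    provides. *)
Lemma recurrent_sym E x y : recurrent E -> reach E x y -> reach E y x.
Proof.
move=> Erec.
apply: (reach_invariant (P := fun z => reach E z x)) (reach_refl E x).
by move=> e /Erec ee xe; exact: reach_trans xe.
Qed.

Lemma walk_reach E x p y : recurrent E -> walk x p y ->
  {subset unzip1 p <= E} -> reach E x y.
Proof.
move=> Erec; elim: p x => [|s p IHp] x /=.
  by move/eqP-> => _; exact: reach_refl.
case/andP=> /eqP <- py sub; apply: (@reach_trans _ _ (tgt s)); last first.
  by apply: IHp py _ => e ep; apply: sub; rewrite in_cons ep orbT.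
have sE : s.1 \in E by apply: sub; rewrite mem_head.
rewrite /src /tgt; case: (s.2); last exact: reach_edge.
exact: Erec.
Qed.

(** Stopping at the first vertex in [W] makes all edges of the walk leave a
    vertex outside [W]; hence they are disjoint from any edges with both ends in
    [W]. *)
Fixpoint into W x p : bool :=
  if p is s :: p' then [&& x \notin W, src s == x & into W (tgt s) p']
  else x \in W.

Lemma into_walk W x p : into W x p -> exists2 y, y \in W & walk x p y.
Proof.
elim: p x => [|s p IHp] x /=; first by exists x.
by case/and3P=> _ -> /IHp.
Qed.

Lemma into_src W x p s : into W x p -> s \in p -> src s \notin W.
Proof.
elim: p x => //= s' p IHp x /and3P[xW /eqP xs' /IHp IH].
by rewrite inE => /predU1P[->|/IH//]; rewrite xs'.
Qed.

Lemma into_suffix W x p s q : into W x (p ++ s :: q) -> into W (tgt s) q.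
Proof. by elim: p x => [|s' p IHp] x /= /and3P[_ _]//; exact: IHp. Qed.

Lemma into_visit W x p y : into W x p -> y \in x :: map tgt p ->
  exists p1 p2, p = p1 ++ p2 /\ into W y p2.
Proof.
move=> xp; rewrite inE => /predU1P[->|/mapP[s /[dup]sp /path.splitPr def_p ->]].
  by exists [::], p.
case: def_p xp => p1 p2 /into_suffix xp.
by exists (rcons p1 s), p2; rewrite cat_rcons.
Qed.

Lemma same_edge_src s s' : s.1 = s'.1 -> src s = src s' \/ src s = tgt s'.
Proof.
by rewrite /src /tgt => ->; case: (s.2); case: (s'.2);
  [left|right|right|left].
Qed.

Lemma edge_visited x p y s : walk x p y -> s.1 \in unzip1 p ->
  src s \in x :: map tgt p.
Proof.
move=> xp /mapP[s' s'p /same_edge_src[->|->]]; first exact: walk_src xp _.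
by rewrite in_cons map_f ?orbT.
Qed.

Lemma uniq_unzip1_cat p q : uniq (unzip1 (p ++ q)) =
  [&& uniq (unzip1 p), ~~ has (mem (unzip1 p)) (unzip1 q) & uniq (unzip1 q)].
Proof. by rewrite /unzip1 map_cat cat_uniq. Qed.

Lemma unzip1_cat p q : unzip1 (p ++ q) = unzip1 p ++ unzip1 q.
Proof. by rewrite /unzip1 map_cat. Qed.

(** Follow [r] until it first meets [W] or one of the trails [p] and [q], then
    continue along that trail: the result avoids the other trail, since before
    the meeting point no vertex of [r] is on [p] or [q]. *)
Lemma first_hit W x r y p q :
    into W y p -> into W y q -> uniq (unzip1 (p ++ q)) ->
    walk x r y -> uniq (unzip1 r) ->
  exists2 r', into W x r' &
    (uniq (unzip1 (r' ++ p)) \/ uniq (unzip1 (r' ++ q))) /\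
    {subset unzip1 r' <= unzip1 (r ++ p ++ q)}.
Proof.
move=> yp yq upq; elim: r x => [|s r IHr] x /=.
  move/eqP=> -> _; exists q => //; split.
    by left; rewrite unzip1_cat uniq_catC -unzip1_cat.
  by move=> e eq; rewrite unzip1_cat mem_cat eq orbT.
case/andP=> /eqP xs sy /andP[sr ur].
have [xW|xW] := boolP (x \in W).
  exists [::] => //; split=> //; left.
  by move: upq; rewrite uniq_unzip1_cat => /andP[].
have [xp|xp] := boolP (x \in y :: map tgt p).
  have [p1 [p2 [def_p xp2]]] := into_visit yp xp.
  exists p2 => //; split; last first.
    move=> e ep2; rewrite !unzip1_cat def_p unzip1_cat /= !(in_cons, mem_cat).
    by rewrite ep2 !orbT.
  by right; move: upq; rewrite def_p -catA unzip1_cat cat_uniq => /and3P[].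
have [xq|xq] := boolP (x \in y :: map tgt q).
  have [q1 [q2 [def_q xq2]]] := into_visit yq xq.
  exists q2 => //; split; last first.
    move=> e eq2; rewrite !unzip1_cat def_q unzip1_cat /= !(in_cons, mem_cat).
    by rewrite eq2 !orbT.
  left; move: upq; rewrite def_q unzip1_cat uniq_catC unzip1_cat -catA cat_uniq.
  by case/and3P=> _ _; rewrite -unzip1_cat.
have [r' sr' [uniq_r' sub_r']] := IHr _ sy ur.
have sr'N : s.1 \notin unzip1 r'.
  apply/negP => /sub_r'; rewrite !unzip1_cat !mem_cat (negbTE sr) /=.
  have [zp _ yzp] := into_walk yp; have [zq _ yzq] := into_walk yq.
  case/orP=> [/(edge_visited yzp)|/(edge_visited yzq)]; rewrite xs.
    by rewrite (negbTE xp).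
  by rewrite (negbTE xq).
have spN : s.1 \notin unzip1 p.
  have [z _ yzp] := into_walk yp.
  by apply: contra xp => /(edge_visited yzp); rewrite xs.
have sqN : s.1 \notin unzip1 q.
  have [z _ yzq] := into_walk yq.
  by apply: contra xq => /(edge_visited yzq); rewrite xs.
exists (s :: r'); first by rewrite /= xW xs eqxx.
split; last first.
  move=> e; rewrite !inE => /predU1P[->|/sub_r']; first by rewrite eqxx.
  by move=> ->; rewrite orbT.
by case: uniq_r' => ur'; [left|right];
   rewrite /= ur' andbT unzip1_cat mem_cat negb_or sr'N.
Qed.

(** The return path of an edge avoids that edge, so that a union of strongly
    connected digraphs has no isthmus as an undirected graph. *)
Lemma detour E s : recurrent E -> s.1 \in E ->
  exists2 r, walk (src s) r (tgt s) &
    [/\ uniq (unzip1 r), {subset unzip1 r <= E} & s.1 \notin unzip1 r].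
Proof.
case: s => e b Erec /= eE.
have [es wes [ues esE esN]] := simple_walk (Erec _ eE).
have eN : e \notin es by apply/negP => /esN; rewrite eqxx.
rewrite /src /tgt; case: b => /=.
  by exists (forward es) => //; rewrite unzip1_forward.
exists (rev (map flip (forward es))); first exact: walk_rev.
rewrite unzip1_rev_flip rev_uniq unzip1_forward; split=> // [f|].
  by rewrite mem_rev => /esE.
by rewrite mem_rev.
Qed.

Definition two_trails E W x : Prop := exists p q,
  [/\ into W x p, into W x q, uniq (unzip1 (p ++ q)) &
      {subset unzip1 (p ++ q) <= E}].

(** If the edge of [s] is on neither trail, the detour around [s] leads from
    [src s] to the trails or to [W]; it is completed to a trail that avoids [p],
    say, and then [s] followed by [p] is the second one. *)
Lemma two_trails_fresh E W s p q : recurrent E -> s.1 \in E ->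
    into W (tgt s) p -> into W (tgt s) q -> src s \notin W ->
    uniq (unzip1 (p ++ q)) -> {subset unzip1 (p ++ q) <= E} ->
    s.1 \notin unzip1 (p ++ q) ->
  two_trails E W (src s).
Proof.
move=> Erec sE hp hq tW upq pqE sN.
have [r tr [ur rE sr]] := detour Erec sE.
have [r' tr' [ur' r'sub]] := first_hit hp hq upq tr ur.
have r'E : {subset unzip1 r' <= E}.
  by move=> e /r'sub; rewrite unzip1_cat mem_cat => /orP[/rE|/pqE].
have sr' : s.1 \notin unzip1 r'.
  apply/negP => /r'sub; rewrite unzip1_cat mem_cat (negbTE sr) /=.
  exact/negP.
have add l : into W (tgt s) l -> s.1 \notin unzip1 l ->
    {subset unzip1 l <= E} -> uniq (unzip1 (r' ++ l)) ->
    two_trails E W (src s).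
  move=> hl sl lE url; exists (s :: l), r'; rewrite /= tW eqxx; split=> //.
    by rewrite unzip1_cat mem_cat negb_or sl sr' uniq_catC -unzip1_cat.
  move=> e; rewrite inE unzip1_cat mem_cat.
  by case/predU1P=> [->//|/orP[/lE|/r'E]].
move: sN pqE; rewrite unzip1_cat mem_cat negb_or => /andP[sp sq] pqE.
case: ur'; apply: add => // e el; apply: pqE; rewrite mem_cat el ?orbT//.
Qed.

(** If [p] already traverses the edge of [s], its part after that edge starts at
    [src s] or at [tgt s]. In the first case this part and [s] followed by [q]
    are the required trails; in the second case it replaces [p] and the edge has
    become free. *)
Lemma two_trails_cut E W s p q : recurrent E -> s.1 \in E ->
    into W (tgt s) p -> into W (tgt s) q -> src s \notin W ->
    uniq (unzip1 (p ++ q)) -> {subset unzip1 (p ++ q) <= E} ->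
    s.1 \in unzip1 p ->
  two_trails E W (src s).
Proof.
move=> Erec sE + hq tW + + /mapP[s' s'p ss'].
case/path.splitPr: s'p => p1 p2 hp.
rewrite -catA cat_cons unzip1_cat cat_uniq /= -ss'.
move=> /and3P[_ _] /andP[sN u2] sub.
have sub2 : {subset unzip1 (p2 ++ q) <= E}.
  by move=> e e2; apply: sub; rewrite mem_cat in_cons e2 !orbT.
have hp2 := into_suffix hp.
have [hss'|hss'] : tgt s' = tgt s \/ tgt s' = src s.
  by rewrite /tgt /src -ss'; case: (s.2); case: (s'.2); [left|right|right|left].
  by rewrite hss' in hp2; exact: (two_trails_fresh _ _ hp2 hq).
rewrite hss' in hp2; exists p2, (s :: q); split=> //=.
- by rewrite tW eqxx.
- rewrite unzip1_cat uniq_catC; apply/andP; split.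
    by move: sN; rewrite unzip1_cat !mem_cat orbC.
  by move: u2; rewrite unzip1_cat uniq_catC.
- move=> e; rewrite unzip1_cat mem_cat in_cons orbCA -mem_cat -unzip1_cat.
  by case/predU1P=> [->//|/sub2].
Qed.

Lemma two_trails_step E W s : recurrent E -> s.1 \in E ->
  two_trails E W (tgt s) -> two_trails E W (src s).
Proof.
move=> Erec sE [p [q [hp hq upq sub]]].
have [tW|tW] := boolP (src s \in W); first by exists [::], [::].
have [sp|sp] := boolP (s.1 \in unzip1 p).
  exact: (two_trails_cut _ _ hp hq).
have [sq|sq] := boolP (s.1 \in unzip1 q).
  apply: (two_trails_cut _ _ hq hp) => //.
    by rewrite unzip1_cat uniq_catC -unzip1_cat.
  by move=> e; rewrite unzip1_cat mem_cat orbC -mem_cat -unzip1_cat => /sub.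
apply: (two_trails_fresh _ _ hp hq) => //.
by rewrite unzip1_cat mem_cat negb_or sp.
Qed.

(** Menger's theorem for two edge-disjoint undirected paths, proved by moving
    the starting point along a path, one edge at a time. *)
Lemma reach_two_trails E W w x : recurrent E -> w \in W -> reach E w x ->
  two_trails E W x.
Proof.
move=> Erec wW; apply: reach_invariant; last by exists [::], [::].
by move=> e eE; apply: (two_trails_step (s := (e, true))).
Qed.

End Ears.

(** * Linking points by edge-disjoint trails *)

Section Linkages.
Context {V : eqType}.
Implicit Types (E : seq (V * V)) (K : seq V) (w x y z t : V).

(** A new edge from the first to the last component, with a trail that justifies
    its length. *)
Definition link : Type := V * seq (dart V) * V.
Implicit Types (l : link) (S : seq link).

Definition arc l : V * V := (l.1.1, l.2).
Definition darts S : seq (dart V) := flatten [seq l.1.2 | l <- S].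

(** All vertices on the trails: the source of each dart is in [K] or is the
    target of the preceding dart. *)
Definition support K S : seq V := K ++ map tgt (darts S).

(** Edge-disjointness bounds the total length of the links by that of [E], and
    the last clause lets the links stand in for [E] between points of [K]. *)
Definition linkage E K S : Prop :=
  [/\ forall l, l \in S -> [/\ walk l.1.1 l.1.2 l.2, l.1.1 \in K & l.2 \in K],
      uniq (unzip1 (darts S)),
      {subset unzip1 (darts S) <= E} &
      forall x y, x \in K -> y \in K -> reach E x y -> reach (map arc S) x y].

Lemma darts_mem S l s : l \in S -> s \in l.1.2 -> s \in darts S.
Proof. by move=> lS sl; apply/flattenP; exists l.1.2 => //; exact: map_f. Qed.

Lemma support_ends E K S s : linkage E K S -> s \in darts S ->
  src s \in support K S /\ tgt s \in support K S.
Proof.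
case=> Slink _ _ _ sS; split; last by rewrite mem_cat map_f ?orbT.
have /flattenP[p /mapP[l lS ->] sl] := sS.
have [wl srcK _] := Slink l lS.
have := walk_src wl sl; rewrite inE mem_cat => /predU1P[->|].
  by rewrite srcK.
by case/mapP=> s' s'l ->; rewrite map_f ?orbT//; exact: darts_mem s'l.
Qed.

(** A vertex on a trail becomes available as an end of links when the trail is
    cut there; the darts in use are the same, in the same order. *)
Lemma subdivide E K S w : recurrent E -> linkage E K S -> w \in support K S ->
  exists2 S', linkage E (w :: K) S' &
    size S' <= (size S).+1 /\ darts S' = darts S.
Proof.
move=> Erec SK; rewrite mem_cat => /orP[wK|/mapP[s /flattenP[p]]].
  have memK : w :: K =i K by move=> x; rewrite inE; case: eqP => // ->.
  exists S; last by split.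
  case: SK => Slink uS SE SR; split=> // [l /Slink|x y].
    by rewrite !memK.
  by rewrite !memK; exact: SR.
case/mapP=> -[[x p'] y] lS ->{p} /= sp' ->{w}.
case: SK => Slink uS SE SR.
case/path.splitPr: sp' lS => p1 p2 lS.
have [/= /walk_split[xw wy] xK yK] := Slink _ lS.
have [S1 [S2 def_S]] : exists S1 S2, S = S1 ++ (x, p1 ++ s :: p2, y) :: S2.
  by case/path.splitPr: lS => S1 S2; exists S1, S2.
rewrite {S}def_S in lS uS SE SR Slink *.
set w := tgt s in xw wy *.
set S' := S1 ++ (x, rcons p1 s, w) :: (w, p2, y) :: S2.
have dS' : darts S' = darts (S1 ++ (x, p1 ++ s :: p2, y) :: S2).
  by rewrite /darts !map_cat !flatten_cat /= -!catA cat_rcons.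
have arcS' a : a \in map arc (S1 ++ (x, p1 ++ s :: p2, y) :: S2) ->
    reach (map arc S') a.1 a.2.
  rewrite !map_cat mem_cat /= inE => aS.
  have [->|aN] := eqVneq a (x, y).
    apply: (@reach_trans _ _ w).
      by apply: (@reach_edge _ _ (x, w)); rewrite mem_cat !inE eqxx orbT.
    by apply: (@reach_edge _ _ (w, y)); rewrite mem_cat !inE eqxx !orbT.
  apply: reach_edge; rewrite mem_cat !inE.
  by move: aS; rewrite /arc /= (negbTE aN) /= => /orP[->//|->]; rewrite !orbT.
have xw' : reach (map arc S') x w.
  by apply: (@reach_edge _ _ (x, w)); rewrite map_cat mem_cat !inE eqxx orbT.
have wy' : reach (map arc S') w y.
  by apply: (@reach_edge _ _ (w, y)); rewrite map_cat mem_cat !inE eqxx !orbT.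
have subE : {subset unzip1 (rcons p1 s) <= E} /\ {subset unzip1 p2 <= E}.
  split=> e ep; apply: SE; rewrite /darts map_cat flatten_cat /= -cat_rcons.
    by rewrite !unzip1_cat !mem_cat ep !orbT.
  by rewrite !unzip1_cat !mem_cat ep !orbT.
have xwE : reach E x w := walk_reach Erec xw subE.1.
have wyE : reach E w y := walk_reach Erec wy subE.2.
exists S'; last by rewrite dS' /S' !size_cat /= !addnS.
split; rewrite ?dS'; [move=> l|exact: uS|exact: SE|move=> u v].
  rewrite mem_cat !inE => lS'.
  have [->|lN1] := eqVneq l (x, rcons p1 s, w); first by rewrite xK eqxx orbT.
  have [->|lN2] := eqVneq l (w, p2, y); first by rewrite yK eqxx orbT.
  have /Slink[wl lK l'K] : l \in S1 ++ (x, p1 ++ s :: p2, y) :: S2.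
    rewrite mem_cat inE; move: lS'; rewrite (negbTE lN1) (negbTE lN2) /=.
    by case/orP=> ->; rewrite ?orbT.
  by rewrite wl lK l'K !orbT.
have SR' a b : a \in K -> b \in K -> reach E a b -> reach (map arc S') a b.
  by move=> aK bK ab; apply: sub_reach (SR _ _ aK bK ab).
rewrite !inE => /predU1P[->|uK] /predU1P[->|vK] uv.
- exact: reach_refl.
- apply: reach_trans wy' _; apply: SR' => //.
  exact/(reach_trans _ uv)/recurrent_sym.
- apply: reach_trans _ xw'; apply: SR' => //.
  exact/(reach_trans uv)/recurrent_sym.
- exact: SR'.
Qed.

(** The two trails from [t] stop at the support, so they are disjoint from the
    trails in use. Their endpoints are made available by two subdivisions, and
    two more links lead to [t] and back. *)
Lemma add_ear E K S w t : recurrent E -> linkage E K S ->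
    w \in support K S -> reach E w t -> t \notin support K S ->
  exists K' S', [/\ linkage E K' S', {subset t :: K <= K'} &
                    size S' <= (size S).+4].
Proof.
move=> Erec SK wS wt tS.
have [p [q [tp tq upq pqE]]] := reach_two_trails Erec wS wt.
have [yp ypS typ] := into_walk tp; have [yq yqS tyq] := into_walk tq.
have [S1 SK1 [size1 darts1]] := subdivide Erec SK ypS.
have : yq \in support (yp :: K) S1.
  move: yqS; rewrite /support darts1 !mem_cat in_cons.
  by case/orP=> ->; rewrite !orbT.
case/(subdivide Erec SK1) => S2 [Slink2 uS2 SE2 SR2] [size2 darts2].
have pE : {subset unzip1 p <= E}.
  by move=> e ep; apply: pqE; rewrite unzip1_cat mem_cat ep.
have qE : {subset unzip1 q <= E}.
  by move=> e eq; apply: pqE; rewrite unzip1_cat mem_cat eq orbT.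
have typE : reach E t yp := walk_reach Erec typ pE.
have tyqE : reach E t yq := walk_reach Erec tyq qE.
(* The trails lead from [t] to [yp] and to [yq]; the first one is reversed, so
   that its link leads to [t]. *)
pose S3 := (yp, rev (map flip p), t) :: (t, q, yq) :: S2.
have ypt : reach (map arc S3) yp t.
  by apply: (@reach_edge _ _ (yp, t)); rewrite mem_head.
have tyq' : reach (map arc S3) t yq.
  by apply: (@reach_edge _ _ (t, yq)); rewrite !inE eqxx orbT.
have old u v : u \in [:: yq, yp & K] -> v \in [:: yq, yp & K] -> reach E u v ->
    reach (map arc S3) u v.
  move=> uK vK uv; apply: sub_reach (SR2 _ _ uK vK uv) => e eS2.
  by apply: reach_edge; rewrite !in_cons eS2 !orbT.
have dS3 : unzip1 (darts S3) = rev (unzip1 p) ++ unzip1 q ++ unzip1 (darts S).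
  by rewrite /darts /= -/(darts S2) !unzip1_cat unzip1_rev_flip darts2 darts1.
exists (t :: [:: yq, yp & K]), S3; split; last first.
- exact: leq_trans size2 _.
- by move=> u; rewrite !in_cons => /predU1P[->|->]; rewrite ?eqxx ?orbT.
split.
- move=> l; rewrite !in_cons => /predU1P[->|/predU1P[->|/Slink2[wl lK l'K]]].
  + by rewrite walk_rev//= !eqxx !orbT.
  + by rewrite tyq /= !eqxx !orbT.
  + by move: lK l'K; rewrite wl !in_cons => -> ->; rewrite !orbT.
- rewrite dS3 catA cat_uniq.
  have -> : uniq (unzip1 (darts S)) by case: SK.
  have perm_pq : perm_eq (rev (unzip1 p) ++ unzip1 q) (unzip1 (p ++ q)).
    by rewrite unzip1_cat perm_cat2r perm_rev.
  rewrite (perm_uniq perm_pq) upq andbT /=; apply/hasPn => _ /mapP[s sS ->].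
  rewrite /= (perm_mem perm_pq); apply/negP => /mapP[s' s'pq ss'].
  have : src s' \notin support K S.
    by move: s'pq; rewrite mem_cat => /orP[/(into_src tp)|/(into_src tq)].
  have [tsS hsS] := support_ends SK sS.
  by case: (same_edge_src (esym ss')) => ->; rewrite ?tsS ?hsS.
- move=> e; rewrite dS3 !mem_cat mem_rev => /or3P[/pE|/qE|]//.
  by case: SK => _ _ + _; apply.
- move=> u v; rewrite (in_cons t) => /predU1P[->|uK].
    rewrite (in_cons t) => /predU1P[-> _|vK tv]; first exact: reach_refl.
    apply: reach_trans tyq' _; apply: old => //; first exact: mem_head.
    exact: reach_trans (recurrent_sym Erec tyqE) tv.
  rewrite (in_cons t) => /predU1P[-> ut|]; last exact: old.
  apply: reach_trans ypt; apply: old => //; first by rewrite !inE eqxx orbT.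
  exact: reach_trans ut typE.
Qed.

Lemma add_isolated E K S t : recurrent E -> linkage E K S ->
    (forall w, w \in K -> ~ reach E w t) -> linkage E (t :: K) S.
Proof.
move=> Erec [Slink uS SE SR] tN; split=> // [l /Slink[-> lK l'K]|u v].
  by rewrite !in_cons lK l'K !orbT.
rewrite !in_cons => /predU1P[->|uK] /predU1P[->|vK] uv.
- exact: reach_refl.
- by case: (tN v vK); exact: recurrent_sym.
- by case: (tN u uK).
- exact: SR.
Qed.

(** Points are added one by one; only the addition of an ear needs as many as
    four new links. *)
Lemma linkage_exists E K0 : recurrent E -> exists K S,
  [/\ linkage E K S, {subset K0 <= K} & size S <= 4 * size K0].
Proof.
move=> Erec; elim: K0 => [|t K0 [K [S [SK K0K sizeS]]]].
  by exists [::], [::]; split=> //; split=> // x y.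
have bump n : n <= (size S).+4 -> n <= 4 * size (t :: K0).
  by move=> /leq_trans; apply; rewrite /= mulnS !ltnS.
have tK0 K' : {subset t :: K <= K'} -> {subset t :: K0 <= K'}.
  move=> sub u; rewrite in_cons => /predU1P[->|/K0K uK]; apply: sub.
    exact: mem_head.
  by rewrite in_cons uK orbT.
have [tS|tS] := boolP (t \in support K S).
  have [S' S'K [sizeS' _]] := subdivide Erec SK tS.
  exists (t :: K), S'; split; [exact: S'K | exact: tK0 |].
  by apply: bump; rewrite (leq_trans sizeS')// !ltnS; do 3![apply: leqW].
have [[w wS wt]|tN] := pselect (exists2 w, w \in support K S & reach E w t).
  have [K' [S' [S'K' sub sizeS']]] := add_ear Erec SK wS wt tS.
  exists K', S'; split; [exact: S'K' | exact: tK0 | exact: bump].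
exists (t :: K), S; split; [|exact: tK0|by apply: bump; do 4![apply: leqW]].
apply: add_isolated => // w wK wt; apply: tN; exists w => //.
by rewrite mem_cat wK.
Qed.

End Linkages.

(** * Bounding the number of edges *)

Section Reduction.
Context {R : realType} {X : metricType R}.
Implicit Types (es fs : seq (X * X)) (e : X * X) (T : seq X) (x y : X).
Local Open Scope ring_scope.

Definition len es : R := \sum_(e <- es) mdist e.1 e.2.

Lemma len_cat es fs : len (es ++ fs) = len es + len fs.
Proof. exact: big_cat. Qed.

Lemma len_cons e es : len (e :: es) = mdist e.1 e.2 + len es.
Proof. exact: big_cons. Qed.

Lemma len_ge0 es : 0 <= len es.
Proof. by apply: sumr_ge0 => e _; exact: mdist_ge0. Qed.

Lemma len_filterC (P : pred (X * X)) es :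
  len es = len [seq e <- es | P e] + len [seq e <- es | ~~ P e].
Proof. by rewrite -len_cat; apply: perm_big; rewrite perm_sym perm_filterC. Qed.

Lemma len_subset es fs : uniq es -> {subset es <= fs} -> len es <= len fs.
Proof.
elim: es fs => [|e es IHes] fs; first by rewrite /len big_nil len_ge0.
move=> /= /andP[ees ues] sub.
have efs : e \in fs by apply: sub; rewrite mem_head.
rewrite [len fs](big_rem e)//= len_cons lerD2l IHes// => f fes.
have : f \in fs by apply: sub; rewrite in_cons fes orbT.
rewrite (perm_mem (perm_to_rem efs)) in_cons => /predU1P[fe|//].
by rewrite -fe fes in ees.
Qed.

Lemma walk_len x p y : walk x p y -> mdist x y <= len (unzip1 p).
Proof.
elim: p x => [|s p IHp] x /=; first by move/eqP->; rewrite mdistxx len_ge0.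
case/andP=> /eqP <- /IHp py; rewrite len_cons.
apply: le_trans (metric_triangle _ (tgt s) _) _; apply: lerD => //.
by rewrite /src /tgt; case: (s.2) => //; rewrite metric_sym.
Qed.

Lemma reach_len es x y : reach es x y -> mdist x y <= len es.
Proof.
case/simple_walk=> fs /walk_len + [ufs fses _].
rewrite unzip1_forward => /le_trans; apply; exact: len_subset.
Qed.

Definition preserves T es fs : Prop :=
  forall x y, x \in T -> y \in T -> reach es x y -> reach fs x y.

(** These two bit vectors are all that the connections between terminals can
    tell about a bridge [e]. *)
Definition profile T es e : (size T).-tuple bool * (size T).-tuple bool :=
  ([tuple of [seq `[< reach es t e.1 >] | t <- in_tuple T]],
   [tuple of [seq `[< reach es e.2 t >] | t <- in_tuple T]]).

Lemma profile_from T es e e' t : profile T es e = profile T es e' ->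
  t \in T -> reach es t e.1 -> reach es t e'.1.
Proof.
case=> /eq_in_map eqT _ tT te; apply/asboolP; rewrite -eqT//; exact/asboolP.
Qed.

Lemma profile_to T es e e' t : profile T es e = profile T es e' ->
  t \in T -> reach es e.2 t -> reach es e'.2 t.
Proof.
case=> _ /eq_in_map eqT tT te; apply/asboolP; rewrite -eqT//; exact/asboolP.
Qed.

Definition shrinks T es fs : Prop :=
  [/\ (size fs < size es)%N, len fs <= len es & preserves T es fs].

(** The bridges [e], [e'] and the edges [r] of a path between them give way to
    one edge from [e.1] to [e'.2], by the triangle inequality. A connection that
    used one of the removed edges starts at a terminal that reaches [e'], hence
    also [e], and ends at one reached from [e], hence also from [e']. It is
    rerouted through the new edge; its two outer parts avoid the removed edges,
    for otherwise [e] or [e'] would lie on a directed cycle. *)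
Lemma merge_bridges T es e e' : e \in es -> e' \in es -> e != e' ->
    ~ reach es e.2 e.1 -> ~ reach es e'.2 e'.1 ->
    profile T es e = profile T es e' -> reach es e.2 e'.1 ->
  exists fs, shrinks T es fs.
Proof.
move=> eE eE' nee' acye acye' prof ee'.
have [r wr [ur rE rN]] := simple_walk ee'.
(* The removed edges; each of them lies between [e] and [e']. *)
pose F := e :: e' :: r.
have Fbetween f : f \in F -> reach es f.1 e'.1 /\ reach es e.2 f.2.
  rewrite !inE => /predU1P[->|/predU1P[->|fr]].
  - by split; [exact/(reach_trans _ ee')/reach_edge | exact: reach_refl].
  - by split; [exact: reach_refl | exact/(reach_trans ee')/reach_edge].
  - have [ef1 f2e'] := forward_reach_mem wr rE fr.
    have ff := reach_edge (rE _ fr).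
    by split; [exact: reach_trans ff f2e' | exact: reach_trans ef1 ff].
have FE : {subset F <= es}.
  by move=> f; rewrite !inE => /predU1P[->//|/predU1P[->//|/rE]].
have uF : uniq F.
  rewrite /= ur !inE negb_or nee' /= andbT; apply/andP; split.
    apply/negP => er; apply: acye.
    by have [] := forward_reach_mem wr rE er.
  apply/negP => e'r; apply: acye'.
  by have [] := forward_reach_mem wr rE e'r.
exists ((e.1, e'.2) :: [seq f <- es | f \notin F]); split.
- rewrite /= !size_filter -(count_predC (mem F) es) -addn2 addnC leq_add2r.
  rewrite -size_filter; apply: (@uniq_leq_size _ [:: e; e']).
    by rewrite /= inE nee'.
  move=> f; rewrite mem_filter !inE.
  by case/orP=> /eqP->; rewrite eqxx ?orbT /= ?eE ?eE'.
- rewrite len_cons (len_filterC (fun f => f \in F) es) lerD2r.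
  apply: (@le_trans _ _ (len F)); last first.
    by apply: len_subset => // f fF; rewrite mem_filter fF FE.
  rewrite !len_cons /= (addrCA (mdist e.1 e.2)).
  apply: le_trans (metric_triangle _ e'.1 _) _;
    rewrite (addrC (mdist e.1 e'.1)) lerD2l.
  apply: le_trans (metric_triangle _ e.2 _) _; rewrite lerD2l.
  by have := walk_len wr; rewrite unzip1_forward.
move=> s t sT tT st.
set fs := _ :: _.
have fsE x y : reach [seq f <- es | f \notin F] x y -> reach fs x y.
  apply: sub_reach => f fE; apply: reach_edge.
  by rewrite /fs in_cons fE orbT.
have [/fsE//|[f /Fbetween[fe' ef] [sf ft]]] := reach_filter F st.
have se : reach fs s e.1.
  have : reach es s e.1.
    by apply: (profile_from (esym prof)) => //; exact: reach_trans fe'.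
  case/(reach_filter F)=> [/fsE//|[g /Fbetween[_ eg] [_ ge]]].
  by case: acye; exact: reach_trans ge.
have e't : reach fs e'.2 t.
  have : reach es e'.2 t.
    by apply: (profile_to prof) => //; exact: reach_trans ft.
  case/(reach_filter F)=> [/fsE//|[g /Fbetween[ge' _] [e'g _]]].
  by case: acye'; exact: reach_trans ge'.
apply: reach_trans se (reach_trans _ e't).
by apply: (@reach_edge _ _ (e.1, e'.2)); rewrite mem_head.
Qed.

(** A connection that used [e'] is rerouted through [e], which has the same
    profile; the detour does not come back to [e'], as [e] and [e'] are not on a
    common path. *)
Lemma drop_bridge T es e e' : e \in es -> e' \in es ->
    profile T es e = profile T es e' ->
    ~ reach es e.2 e'.1 -> ~ reach es e'.2 e.1 -> e != e' ->
  exists fs, shrinks T es fs.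
Proof.
move=> eE eE' prof nee' ne'e neq.
pose fs := [seq f <- es | f \notin [:: e']].
exists fs; split.
- rewrite size_filter -(count_predC (mem [:: e']) es) -[ltnLHS]add0n ltn_add2r.
  by rewrite -has_count; apply/hasP; exists e' => //; exact: mem_head.
- by rewrite (len_filterC (fun f => f \in [:: e']) es) lerDr len_ge0.
move=> s t sT tT /(reach_filter [:: e'])[//|[_ /[!inE]/eqP-> [se' e't]]].
have /(reach_filter [:: e'])[se|[_ /[!inE]/eqP-> [_ /ne'e//]]] :=
  profile_from (esym prof) sT se'.
have /(reach_filter [:: e'])[et|[_ /[!inE]/eqP-> [/nee'//]]] :=
  profile_to (esym prof) tT e't.
apply: reach_trans se (reach_trans _ et).
by apply: reach_edge; rewrite mem_filter inE neq.
Qed.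

Definition bridges es := [seq e <- es | ~~ `[< reach es e.2 e.1 >]].
Definition recurrent_part es := [seq e <- es | `[< reach es e.2 e.1 >]].

(** Two bridges with the same profile allow a reduction, and there are [2 ^ n *
    2 ^ n] profiles. *)
Lemma few_bridges_or_shrinks T es :
  (uniq es /\ (size (bridges es) <= 4 ^ size T)%N) \/
  exists fs, shrinks T es fs.
Proof.
have [ues|nues] := boolP (uniq es); last first.
  right; exists (undup es); split.
  - by rewrite ltn_size_undup.
  - by apply: len_subset; [exact: undup_uniq | move=> e; rewrite mem_undup].
  - move=> x y _ _; apply: sub_reach => e eE.
    by apply: reach_edge; rewrite mem_undup.
have [?|noshrink] := pselect (exists fs, shrinks T es fs); first by right.
left; split=> //.
have inj : {in bridges es &, injective (profile T es)}.
  move=> e e'; rewrite !mem_filter => /andP[/asboolPn acye eE].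
  move=> /andP[/asboolPn acye' eE'] prof.
  apply/eqP/negPn/negP => nee'; apply: noshrink.
  have [ee'|nreach] := pselect (reach es e.2 e'.1).
    exact: (merge_bridges eE eE').
  have [e'e|nreach'] := pselect (reach es e'.2 e.1).
    by apply: (merge_bridges eE' eE) => //; rewrite eq_sym.
  exact: (drop_bridge eE eE').
rewrite -(size_map (profile T es)) -(card_uniqP _); last first.
  by rewrite map_inj_in_uniq// filter_uniq.
apply: leq_trans (max_card _) _.
by rewrite card_prod !card_tuple card_bool -expnMn.
Qed.

Lemma few_bridges T es : exists fs, [/\ uniq fs, len fs <= len es,
  preserves T es fs & (size (bridges fs) <= 4 ^ size T)%N].
Proof.
have [n] := ubnP (size es); elim: n es => // n IHn es; rewrite ltnS => size_es.
have [[ues few]|[fs [size_fs len_fs pres_fs]]] := few_bridges_or_shrinks T es.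
  by exists es; split.
have [gs [ugs len_gs pres_gs few]] := IHn fs (leq_trans size_fs size_es).
exists gs; split=> // [|x y xT yT]; first exact: le_trans len_gs len_fs.
by move=> /(pres_fs x y xT yT); exact: pres_gs.
Qed.

(** All edges of a directed cycle lie on that cycle, so the return paths stay in
    the recurrent part. *)
Lemma recurrent_partP es : recurrent (recurrent_part es).
Proof.
move=> e; rewrite mem_filter => /andP[/asboolP/simple_walk[r wr [_ rE _]] eE].
apply: (forward_reach wr) => f fr; rewrite mem_filter rE// andbT.
have [ef fe] := forward_reach_mem wr rE fr; apply/asboolP.
exact: reach_trans fe (reach_trans (reach_edge eE) ef).
Qed.

(** At most [4 ^ n] bridges, and four links for each of the [n] terminals and
    the [2 * 4 ^ n] ends of bridges. *)
Definition size_bound (n : nat) : nat := (4 ^ n + 4 * (n + 2 * 4 ^ n))%N.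

(** The bridges that remain after [few_bridges] are kept, and the recurrent part
    is replaced by a linkage of the terminals and the ends of the bridges. A
    path between terminals is followed vertex by vertex, keeping a linked point
    that is already reached in the new list and lies in the same strongly
    connected component as the current vertex. *)
Theorem bounded_reduction T es : exists fs,
  [/\ (size fs <= size_bound (size T))%N, len fs <= len es &
      preserves T es fs].
Proof.
have [fs [ufs len_fs pres_fs few]] := few_bridges T es.
pose I := T ++ [seq e.1 | e <- bridges fs] ++ [seq e.2 | e <- bridges fs].
have Erec := @recurrent_partP fs.
have [K [S [[Slink uS SE SR] IK sizeS]]] := linkage_exists I Erec.
exists (bridges fs ++ map arc S); split.
- rewrite size_cat size_map /size_bound leq_add//.
  apply: leq_trans sizeS _; rewrite leq_mul2l /= /I !size_cat !size_map.
  by rewrite leq_add2l addnn -mul2n leq_mul2l.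
- apply: le_trans len_fs.
  rewrite (len_filterC (fun e => ~~ `[< reach fs e.2 e.1 >]) fs) len_cat lerD2l.
  apply: (@le_trans _ _ (len (unzip1 (darts S)))).
    elim: (S) Slink => [|l S' IHS] Slink.
      by rewrite /len /darts /= !big_nil.
    rewrite /= len_cons /darts /= unzip1_cat len_cat; apply: lerD.
      by have [/walk_len] := Slink l (mem_head _ _).
    by apply: IHS => l' l'S; apply: Slink; rewrite in_cons l'S orbT.
  apply: len_subset => // e /SE; rewrite !mem_filter => /andP[/= ee ->].
  by rewrite /= ee.
move=> s t sT tT /(pres_fs s t sT tT) st.
have bridgeK e : e \in bridges fs -> e.1 \in K /\ e.2 \in K.
  by move=> eB; split; apply: IK; rewrite !mem_cat map_f ?orbT.
have SR' x y : x \in K -> y \in K -> reach (recurrent_part fs) x y ->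
    reach (bridges fs ++ map arc S) x y.
  move=> xK yK xy; apply: sub_reach (SR x y xK yK xy) => e eS.
  by apply: reach_edge; rewrite mem_cat eS orbT.
have TK x : x \in T -> x \in K by move=> xT; apply: IK; rewrite mem_cat xT.
pose served x := exists k, [/\ k \in K, reach (bridges fs ++ map arc S) s k &
  reach (recurrent_part fs) k x].
suff [k [kK sk kt]] : served t.
  by apply: reach_trans sk _; apply: SR' => //; exact: TK.
apply: reach_invariant st; last first.
  by exists s; split; [exact: TK | exact: reach_refl | exact: reach_refl].
move=> e eE [k [kK sk ke]].
have [eB|eC] := boolP (e \in bridges fs); last first.
  exists k; split=> //; apply: reach_trans ke _; apply: reach_edge.
  by move: eC; rewrite !mem_filter eE !andbT negbK.
have [e1K e2K] := bridgeK e eB.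
exists e.2; split=> //; last exact: reach_refl.
apply: reach_trans sk (reach_trans (SR' _ _ kK e1K ke) _).
by apply: reach_edge; rewrite mem_cat eB.
Qed.

End Reduction.

(** * The space of edge lists of a given size *)

Section Configurations.
Context {R : realType} {X : metricType R}.
Implicit Types (x y a b : X) (fs gs hs : seq (X * X)).
Local Open Scope classical_set_scope.
Local Open Scope ring_scope.

Lemma closed_mdist_ball a (r : R) : closed [set x | mdist a x <= r].
Proof.
move=> x cl_x /=; apply/ler_addgt0Pl => e e0.
have [y [/= ay]] := cl_x _ (nbhsx_ballx x e e0).
rewrite ballEmdist /= => xy.
apply: le_trans (metric_triangle _ y _) _; rewrite addrC lerD//.
by rewrite metric_sym ltW.
Qed.

Lemma compact_mdist_ball a (r : R) : finitely_compact X ->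
  compact [set x | mdist a x <= r].
Proof.
move=> Xc; apply: Xc; first exact: closed_mdist_ball.
exists (r + r) => x y /= ax ay; apply: le_trans (metric_triangle _ a _) _.
by rewrite lerD// metric_sym.
Qed.

Lemma continuous_sum (I : Type) (T : topologicalType) (F : I -> T -> R)
    (s : seq I) : (forall i, continuous (F i)) ->
  continuous (fun t => \sum_(i <- s) F i t).
Proof.
move=> Fc; elim: s => [|i s IHs].
  by under eq_fun do rewrite big_nil; exact: cst_continuous.
under eq_fun do rewrite big_cons.
by move=> t; apply: cvgD; [exact: Fc|exact: IHs].
Qed.

Context {N : nat}.

Local Notation config := {ptws ('I_N * bool) -> X}.
Implicit Types (f g : config) (c : 'I_N * bool).

Definition arcs f : seq (X * X) :=
  [seq (f (i, false), f (i, true)) | i <- enum 'I_N].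

Lemma near_coord f c (P : set X) : nbhs (f c) P -> \forall g \near f, P (g c).
Proof. exact: (@proj_continuous _ (fun _ => X) c f P). Qed.

Lemma continuous_mdist_coord c c' : continuous (fun f => mdist (f c) (f c')).
Proof.
move=> f; have ff := nbhs_filter f; apply/cvgrPdist_le => e e0.
have e2 : 0 < e / 2 by rewrite divr_gt0.
have near_ball k : \forall g \near f, ball (f k) (e / 2) (g k).
  by apply: near_coord; exact: nbhsx_ballx.
near=> g.
have : ball (f c) (e / 2) (g c) by near: g; exact: near_ball.
have : ball (f c') (e / 2) (g c') by near: g; exact: near_ball.
rewrite !ballEmdist /= => d2 d1.
have t1 := metric_triangle (f c) (g c) (f c').
have t2 := metric_triangle (g c) (g c') (f c').
have t3 := metric_triangle (g c) (f c) (g c').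
have t4 := metric_triangle (f c) (f c') (g c').
rewrite (metric_sym (g c') (f c')) in t2.
rewrite (metric_sym (g c) (f c)) in t3.
by rewrite ler_distl; apply/andP; split; lra.
Unshelve. all: by end_near. Qed.

Lemma continuous_len : continuous (fun f => len (arcs f)).
Proof.
have -> : (fun f => len (arcs f)) =
    fun f => \sum_(i <- enum 'I_N) mdist (f (i, false)) (f (i, true)).
  by apply/funext => f; rewrite /len /arcs big_map.
apply: continuous_sum => i; exact: continuous_mdist_coord.
Qed.

(** An equality of continuous maps can only hold near [f] if it holds at [f],
    because [X] is Hausdorff. *)
Lemma near_neq f (p q : config -> X) : {for f, continuous p} ->
  {for f, continuous q} -> \forall g \near f, p g = q g -> p f = q f.
Proof.
move=> pc qc; have ff := nbhs_filter f.
have [pq|pq] := eqVneq (p f) (q f); first by apply: (@filterE _ _ ff) => g _.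
have d0 : 0 < mdist (p f) (q f) / 2 by rewrite divr_gt0// mdist_gt0.
have np := pc _ (nbhsx_ballx _ _ d0); have nq := qc _ (nbhsx_ballx _ _ d0).
near=> g => pqg.
have : ball (p f) (mdist (p f) (q f) / 2) (p g) by near: g; exact: np.
have : ball (q f) (mdist (p f) (q f) / 2) (q g) by near: g; exact: nq.
rewrite !ballEmdist /= -pqg => d1 d2.
have := metric_triangle (p f) (p g) (q f); rewrite leNgt => /negP[].
by rewrite [ltRHS]splitr ltrD// metric_sym.
Unshelve. all: by end_near. Qed.

(** If [g] is close enough to [f], all equalities between coordinates of [g], or
    between a coordinate and [a] or [b], hold for [f] too. Therefore a path in
    [arcs g] from [a] to [b] yields a path in [arcs f] through the same indices.
    *)
Lemma closed_reach a b : closed [set f | reach (arcs f) a b].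
Proof.
have coord c f : {for f, continuous (fun g : config => g c)}.
  exact: (@proj_continuous _ (fun _ => X) c f).
have cstc x f : {for f, continuous (fun _ : config => x)}.
  exact: cst_continuous.
move=> f cl_f /=; have ff := nbhs_filter f.
have near_a : \forall g \near f, forall c, g c = a -> f c = a.
  apply: (@filter_forall _ _
    (fun c (g : config) => g c = a -> f c = a) _ ff) => c.
  exact: (near_neq (coord c f) (cstc a f)).
have near_b : \forall g \near f, forall c, b = g c -> b = f c.
  apply: (@filter_forall _ _
    (fun c (g : config) => b = g c -> b = f c) _ ff) => c.
  exact: (near_neq (cstc b f) (coord c f)).
have near_c : \forall g \near f, forall c c', g c = g c' -> f c = f c'.
  apply: (@filter_forall _ _
    (fun c (g : config) => forall c', g c = g c' -> f c = f c') _ ff) => c.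
  apply: (@filter_forall _ _
    (fun c' (g : config) => g c = g c' -> f c = f c') _ ff) => c'.
  exact: (near_neq (coord c f) (coord c' f)).
have [g [/= ab [[ga gb] gc]]] :=
  cl_f _ (filterI (filterI near_a near_b) near_c).
(* [x] occurs in [g] at a place [c] whose value in [f] is reached from [a]. *)
pose P x := x = a \/ exists2 c, x = g c & reach (arcs f) a (f c).
have : P b.
  apply: reach_invariant ab; last by left.
  move=> _ /mapP[i _ ->] /= Pi; right; exists (i, true) => //.
  have stepi : reach (arcs f) (f (i, false)) (f (i, true)).
    apply: (@reach_edge _ _ (f (i, false), f (i, true))).
    by apply: map_f; rewrite mem_enum.
  apply: reach_trans _ stepi.
  by case: Pi => [/ga->|[c /gc->]//]; exact: reach_refl.
by case=> [->|[c /gb-> //]]; exact: reach_refl.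
Qed.

End Configurations.

(** * Existence of a shortest network *)

Section Shortest.
Context {R : realType} {X : metricType R}.
Implicit Types (A B : {fset X}) (fs gs hs : seq (X * X)) (G H : digraph X).
Local Open Scope ring_scope.

Definition links_all A B fs : Prop :=
  forall a b, a \in A -> b \in B -> reach fs a b.

Section Representation.
Context (A B : {fset X}) (a0 : X) (a0A : a0 \in A).

Definition spread : R := \sum_(a <- A) mdist a0 a.

Lemma mdist_spread a : a \in A -> mdist a0 a <= spread.
Proof.
move=> aA; rewrite /spread (big_rem a)//= lerDl.
by apply: sumr_ge0 => b _; exact: mdist_ge0.
Qed.

(** The edges that cannot be reached from [A] could be anywhere, so they are
    discarded first; the others stay in a ball around [a0]. The list is then
    padded with loops at [a0], which have length zero. *)
Lemma represent N hs : (size hs <= N)%N -> links_all A B hs ->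
  exists f : 'I_N * bool -> X,
    [/\ len (arcs f) <= len hs, links_all A B (arcs f) &
        forall c, mdist a0 (f c) <= spread + len hs].
Proof.
move=> size_hs hsAB.
pose live (e : X * X) := `[< exists2 a, a \in A & reach hs a e.1 >].
pose gs := [seq e <- hs | live e].
pose fs := gs ++ nseq (N - size gs) (a0, a0).
have size_gs : (size gs <= N)%N.
  by apply: leq_trans size_hs; rewrite size_filter count_size.
have size_fs : size fs = N by rewrite size_cat size_nseq subnKC.
pose f (c : 'I_N * bool) :=
  let e := nth (a0, a0) fs c.1 in if c.2 then e.2 else e.1.
have arcs_f : arcs f = fs.
  rewrite -[RHS](mkseq_nth (a0, a0)) size_fs /mkseq -val_enum_ord -map_comp.
  by apply: eq_map => i; rewrite /f /=; case: (nth _ _ _).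
have in_box x : (exists2 a, a \in A & reach hs a x) ->
    mdist a0 x <= spread + len hs.
  case=> a aA ax; apply: le_trans (metric_triangle _ a _) _.
  by apply: lerD; [exact: mdist_spread | exact: reach_len].
exists f; split.
- rewrite arcs_f len_cat.
  have -> : len (nseq (N - size gs) (a0, a0)) = 0.
    apply: big1_seq => e /=; rewrite mem_nseq => /andP[_ /eqP->].
    exact: mdistxx.
  by rewrite addr0 (len_filterC live hs) lerDl len_ge0.
- move=> a b aA bB; rewrite arcs_f.
  suff [_ //] : reach hs a b /\ reach fs a b.
  apply: (reach_invariant (P := fun x => reach hs a x /\ reach fs a x))
    (hsAB a b aA bB); last by split; exact: reach_refl.
  move=> e eE [ae ae']; split; first exact: reach_trans ae (reach_edge eE).
  apply: reach_trans ae' (reach_edge _).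
  rewrite mem_cat mem_filter eE andbT; apply/orP; left.
  by apply/asboolP; exists a.
- move=> [i b]; have : nth (a0, a0) fs i \in fs by rewrite mem_nth ?size_fs.
  rewrite {1}/fs mem_cat mem_nseq mem_filter.
  case/orP=> [/andP[/asboolP[a aA ae] eE]|].
    apply: in_box; exists a => //; rewrite /f /=; case: b => //.
    exact: reach_trans ae (reach_edge eE).
  case/andP=> _ /eqP e0; apply: in_box; exists a0 => //.
  by rewrite /f /= e0; case: b; exact: reach_refl.
Qed.

End Representation.

(** The competitors that are not longer than the list [e0] of all edges from [A]
    to [B] are represented, up to a reduction, in a compact set of
    configurations on which the length attains its minimum. *)
Lemma shortest_list A B a0 : finitely_compact X -> a0 \in A ->
  exists fs, links_all A B fs /\
    forall gs, links_all A B gs -> len fs <= len gs.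
Proof.
move=> Xc a0A.
pose T : seq X := A ++ B.
pose N := size_bound (size T).
pose e0 := [seq (a, b) | a <- A, b <- B].
have e0AB : links_all A B e0.
  move=> a b aA bB; apply: (@reach_edge _ _ (a, b)).
  by apply/allpairsP; exists (a, b).
pose r := spread A a0 + len e0.
pose S : set {ptws ('I_N * bool) -> X} :=
  ([set f | forall c, mdist a0 (f c) <= r] `&`
   [set f | links_all A B (arcs f)])%classic.
have normal gs : links_all A B gs -> len gs <= len e0 ->
    exists2 f, S f & len (arcs f) <= len gs.
  move=> gsAB le_e0; have [hs [size_hs len_hs pres]] := bounded_reduction T gs.
  have hsAB : links_all A B hs.
    move=> a b aA bB; apply: pres; rewrite ?mem_cat ?aA ?bB ?orbT//.
    exact: gsAB.
  have [f [len_f fAB f_box]] := represent a0A size_hs hsAB.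
  exists f; last exact: le_trans len_f len_hs.
  split=> // c /=; apply: le_trans (f_box c) _; rewrite lerD2l.
  exact: le_trans len_hs le_e0.
have [f0 Sf0 len_f0] := normal _ e0AB (lexx _).
have S_compact : compact S.
  apply: compact_closedI.
    apply: (@tychonoff ('I_N * bool)%type (fun=> X : topologicalType)
      (fun=> [set x | mdist a0 x <= r]%classic)
      (fun=> @compact_mdist_ball R X a0 r Xc)).
  move=> f cl_f a b aA bB; apply: closed_reach => U /cl_f[g [gAB Ug]].
  by exists g; split=> //; exact: gAB.
have [f /set_mem[_ fAB] f_min] := compact_EVT_min (ex_intro _ f0 Sf0) S_compact
  (continuous_subspaceT (@continuous_len R X N)).
exists (arcs f); split=> // gs gsAB.
have [gs_e0|/ltW e0_gs] := leP (len gs) (len e0).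
  have [g Sg] := normal gs gsAB gs_e0.
  by apply: le_trans; apply: f_min; exact: mem_set.
apply: le_trans e0_gs; apply: le_trans len_f0.
by apply: f_min; exact: mem_set.
Qed.

Definition used_vertices A B fs : {fset X} :=
  [fset x | x in A ++ B ++ [seq e.1 | e <- fs] ++ [seq e.2 | e <- fs]]%fset.

Definition used_edges fs : {fset X * X} :=
  [fset e | e in [seq e <- fs | e.1 != e.2]]%fset.

Lemma used_edgesP A B fs e : e \in used_edges fs ->
  [&& e.1 \in used_vertices A B fs, e.2 \in used_vertices A B fs & e.1 != e.2].
Proof.
rewrite in_fset /= mem_filter => /andP[-> eE].
by rewrite !in_fset /= !mem_cat !(map_f _ eE) !orbT.
Qed.

Definition digraph_of A B fs : digraph X := Digraph (@used_edgesP A B fs).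

Lemma digraph_of_length A B fs : network_length (digraph_of A B fs) <= len fs.
Proof.
apply: len_subset; first exact: fset_uniq.
by move=> e; rewrite in_fset /= mem_filter => /andP[].
Qed.

(** Loops disappear in the digraph, but a path without repeated vertices uses
    none. *)
Lemma digraph_of_network A B fs : links_all A B fs ->
  is_network A B (digraph_of A B fs).
Proof.
move=> fsAB; split.
  apply/fsubsetP => x; rewrite in_fsetU in_fset /= !mem_cat.
  by case/orP=> ->; rewrite ?orbT.
move=> a b aA bB; have [p0 /shortenP[p ap up _] ->] := fsAB a b aA bB.
exists p; split=> //; first by rewrite in_fset /= mem_cat aA.
elim: p a ap up {aA} => //= x p IHp a /andP[ax xp] /and3P[axp xpN upx].
rewrite IHp ?xpN ?upx//= andbT in_fset /= mem_filter ax andbT /=.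
by apply: contraNneq axp => ->; rewrite mem_head.
Qed.

Lemma network_links A B G : is_network A B G -> links_all A B (edges G).
Proof.
by case=> _ GAB a b aA bB; have [p [_ ap _ <-]] := GAB a b aA bB; exists p.
Qed.

End Shortest.

Theorem corollary1 (R : realType) (X : metricType R)
    (X_compact : finitely_compact X) (X_geodesic : geodesically_connected X)
    (A B : {fset X}) :
  exists G : digraph X, is_shortest_network A B G.
Proof.
have [fs [fsAB fs_min]] : exists fs : seq (X * X), links_all A B fs /\
    forall gs, links_all A B gs -> (len fs <= len gs)%R.
  have [A0|[a aA]] := fset_0Vmem A; last exact: shortest_list aA.
  exists [::]; split=> [a b|gs _]; first by rewrite A0 in_fset0.
  by rewrite /len big_nil len_ge0.
exists (digraph_of A B fs); split; first exact: digraph_of_network.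
move=> H /network_links/fs_min; apply: le_trans.
exact: digraph_of_length.
Qed.
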